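(* There is a $12\,CS\to1\,CS$ distillation protocol at distance $3$, given by the matrix $G\in\mathbb F_4^{4\times12}$ $$\begin{pmatrix} 0&0&1&0&0&1&0&\omega^2&1&\omega&\omega^2&\omega\\\hline 0&0&0&0&1&1&1&1&1&1&1&1\\ 0&1&1&1&\omega&\omega^2&0&0&0&1&1&1\\ 1&1&\omega&\omega^2&0&0&1&\omega&\omega^2&1&\omega&\omega^2\end{pmatrix}$$ with one logical row and three stabilizer rows. That is, $G$ has full rank and satisfies $$\sum_ig_{a,i}g_{b,i}g_{c,i}=\begin{cases}1&a=b=c=1\\0&\text{otherwise}\end{cases}\qquad(1\le a,b,c\le4);$$ consequently $D_G=C\,(CS\otimes I)$ for some diagonal Clifford unitary $C$ ($CS$ acting on the first qudit); and the $Z$-distance of the code is $3$.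
   Context: $\mathbb F_4=\{0,1,\omega,\omega^2\}$, $\omega^2=\omega+1$. Writing $\gamma=b_1\omega+b_2\omega^2$ ($b_1,b_2\in\{0,1\}$) identifies an $\mathbb F_4$-qudit with two qubits, and $CS|\gamma\rangle=i^{b_1b_2}|\gamma\rangle$; put $c(\gamma)=b_1b_2$. A full-rank matrix $G\in\mathbb F_4^{m\times n}$ with $k$ logical rows defines a CSS code on $n$ $\mathbb F_4$-qudits: the first $k$ rows are $X$-logical operators, the last $m-k$ rows are $X$-stabilizer generators. Its $Z$-distance is the minimum Hamming weight over $\mathbb F_4$ of a vector in $\mathbb F_4^n$ orthogonal (for $\sum x_iy_i$) to all stabilizer rows but not to at least one logical row. The unitary on $m$ qudits ($2m$ qubits) induced by applying $CS$ to each of the $n$ physical qudits is $D_G|u\rangle=i^{\sum_{i=1}^nc(\sum_au_ag_{a,i})}|u\rangle$, $u\in\mathbb F_4^m$ (inner sum in $\mathbb F_4$, outer sum over integers). *)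

(* Defs.v *)
From HB Require Import structures.
From mathcomp Require Import all_boot all_order all_algebra all_field.

Set Implicit Arguments.
Unset Strict Implicit.
Unset Printing Implicit Defensive.

Import Order.TTheory GRing.Theory Num.Theory.
Local Open Scope ring_scope.
Local Open Scope sesquilinear_scope.

(* The field with four elements is any [F : finFieldType] with [#|F| = 4],
   together with a chosen [w : F] such that [w ^+ 2 = w + 1].                 *)

Definition qudit_of_bits (F : finFieldType) (w : F) (b : bool * bool) : F :=
  w *+ b.1 + w ^+ 2 *+ b.2.

(* The default is never used, by [bitsP].                                     *)
Definition bits (F : finFieldType) (w : F) (g : F) : bool * bool :=
  odflt (false, false) [pick b | g == qudit_of_bits w b].

Lemma F4_addrr (F : finFieldType) (hF : #|F| = 4%N) (x : F) : x + x = 0.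
Proof.
have N1 : 1 = -1 :> F by rewrite -[RHS]expf_card hF -signr_odd expr0.
by rewrite -{2}[x]mul1r N1 mulN1r subrr.
Qed.

Lemma bitsP (F : finFieldType) (hF : #|F| = 4%N) (w : F) (hw : w ^+ 2 = w + 1)
    (g : F) (b : bool * bool) : (bits w g == b) = (g == qudit_of_bits w b).
Proof.
have w0 : (w == 0) = false.
  by apply/eqP=> w0; move/eqP: hw; rewrite w0 expr0n add0r eq_sym oner_eq0.
have w10 : (w + 1 == 0) = false by rewrite -hw expf_eq0 w0.
have w1 : (w == 1) = false.
  by apply/eqP=> w1; move: w10; rewrite w1 F4_addrr // eqxx.
have w1w : (w + 1 == w) = false.
  by rewrite -{2}[w]addr0 (inj_eq (addrI w)) oner_eq0.
have w11 : (w + 1 == 1) = false.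
  by rewrite -{2}[1]add0r (inj_eq (addIr 1)) w0.
have inj : injective (qudit_of_bits w).
  have ww : w + (w + 1) = 1 by rewrite addrA F4_addrr ?add0r.
  case=> [] [] [] [[] []] //=; rewrite /qudit_of_bits /= hw;
    rewrite ?mulr0n ?mulr1n ?ww ?addr0 ?add0r // => /eqP;
    rewrite ?(w0, w10, w1, w1w, w11, oner_eq0) // eq_sym;
    by rewrite ?(w0, w10, w1, w1w, w11, oner_eq0).
have [h hK Kh] : bijective (qudit_of_bits w).
  by apply: inj_card_bij => //; rewrite hF card_prod !card_bool.
rewrite /bits; case: pickP => [b' /eqP -> | /(_ (h g))]; last first.
  by rewrite Kh eqxx.
by rewrite /= (inj_eq inj).
Qed.

(* CS |g> = 'i ^+ c g |g>.                                                    *)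
Definition cphase (F : finFieldType) (w : F) (g : F) : nat :=
  ((bits w g).1 && (bits w g).2)%N.

(* Operators on the space with orthonormal basis [T]: an operator is given by
   its matrix coefficients [A x y] = <x|A|y>, and [opmx] packs them into a
   square matrix.                                                             *)
Definition opmx (C : numClosedFieldType) (T : finType) (A : T -> T -> C) :
    'M[C]_#|T| :=
  \matrix_(p, q) A (enum_val p) (enum_val q).

Definition diagop (C : numClosedFieldType) (T : finType) (f : T -> C) :
    T -> T -> C :=
  fun x y => f x *+ (x == y).

Definition tensop (C : numClosedFieldType) (I T : finType)
    (A : I -> T -> T -> C) : {ffun I -> T} -> {ffun I -> T} -> C :=
  fun u v => \prod_i A i (u i) (v i).

Inductive pauli_label := PauliI | PauliX | PauliY | PauliZ.

Definition pauli1 (C : numClosedFieldType) (P : pauli_label) :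
    bool -> bool -> C :=
  match P with
  | PauliI => fun x y => (x == y)%:R
  | PauliX => fun x y => (x != y)%:R
  | PauliY => fun x y => if x == y then 0 else if x then 'i else - 'i
  | PauliZ => fun x y => (-1) ^+ x *+ (x == y)
  end.

(* A basis state of [m] qudits is a basis state of [2 * m] qubits; the qubits
   are labelled by ['I_m * bool], [(a, false)] carrying the coefficient of [w]
   and [(a, true)] that of [w ^+ 2] in the [a]-th qudit.                      *)
Definition qubits (F : finFieldType) (w : F) (m : nat) (u : {ffun 'I_m -> F}) :
    {ffun 'I_m * bool -> bool} :=
  [ffun p => if p.2 then (bits w (u p.1)).2 else (bits w (u p.1)).1].

(* The Pauli group on these [2 * m] qubits, with phases the powers of ['i].   *)
Definition is_pauli (C : numClosedFieldType) (F : finFieldType) (w : F)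
    (m : nat) (A : 'M[C]_#|{ffun 'I_m -> F}|) : Prop :=
  exists (k : nat) (P : 'I_m * bool -> pauli_label),
    A = 'i ^+ k *:
        opmx (fun u v => tensop (fun q => @pauli1 C (P q))
                                (qubits w u) (qubits w v)).

Definition is_clifford (C : numClosedFieldType) (F : finFieldType) (w : F)
    (m : nat) (U : 'M[C]_#|{ffun 'I_m -> F}|) : Prop :=
  U \is unitarymx /\
  forall A : 'M[C]_#|{ffun 'I_m -> F}|,
    is_pauli w A -> is_pauli w (U *m A *m U ^t*).

Definition CS (C : numClosedFieldType) (F : finFieldType) (w : F) :
    F -> F -> C :=
  diagop (fun g => 'i ^+ cphase w g).

(* CS on the first of [m.+1] qudits, identity on the others.                  *)
Definition CS_first (C : numClosedFieldType) (F : finFieldType) (w : F)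
    (m : nat) : 'M[C]_#|{ffun 'I_m.+1 -> F}| :=
  opmx (tensop (fun a : 'I_m.+1 =>
                  if a == ord0 then CS C w else diagop (fun=> 1))).

Definition D_ (C : numClosedFieldType) (F : finFieldType) (w : F) (m n : nat)
    (G : 'M[F]_(m, n)) : 'M[C]_#|{ffun 'I_m -> F}| :=
  opmx (diagop (fun u : {ffun 'I_m -> F} =>
    'i ^+ (\sum_(i < n) cphase w (\sum_(a < m) u a * G a i)%R)%N)).

Definition hweight (F : finFieldType) (n : nat) (x : 'rV[F]_n) : nat :=
  #|[set i | x 0 i != 0]|.

Definition dotv (F : finFieldType) (n : nat) (x y : 'rV[F]_n) : F :=
  \sum_i x 0 i * y 0 i.

(* The first [k] rows of [G] are logical, the last [r] are stabilizers.       *)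
Definition nontrivial_Z (F : finFieldType) (k r n : nat)
    (G : 'M[F]_(k + r, n)) (x : 'rV[F]_n) : Prop :=
  (forall j : 'I_r, dotv x (row (rshift k j) G) = 0) /\
  (exists j : 'I_k, dotv x (row (lshift r j) G) <> 0).

Definition is_Zdistance (F : finFieldType) (k r n : nat)
    (G : 'M[F]_(k + r, n)) (d : nat) : Prop :=
  (exists2 x : 'rV[F]_n, nontrivial_Z G x & hweight x = d) /\
  (forall x : 'rV[F]_n, nontrivial_Z G x -> (d <= hweight x)%N).

Definition G12_rows (F : finFieldType) (w : F) : seq (seq F) :=
  let v := w ^+ 2 in
  [:: [:: 0; 0; 1; 0; 0; 1; 0; v; 1; w; v; w];
      [:: 0; 0; 0; 0; 1; 1; 1; 1; 1; 1; 1; 1];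
      [:: 0; 1; 1; 1; w; v; 0; 0; 0; 1; 1; 1];
      [:: 1; 1; w; v; 0; 0; 1; w; v; 1; w; v]].

Definition G12 (F : finFieldType) (w : F) : 'M[F]_(1 + 3, 12) :=
  \matrix_(a, i) nth 0 (nth [::] (G12_rows w) a) i.

(* Main.v *)
Require Import Defs.
From mathcomp Require Import all_boot all_order all_algebra all_field ring.

Set Implicit Arguments.
Unset Strict Implicit.
Unset Printing Implicit Defensive.

Import Order.TTheory GRing.Theory Num.Theory.
Local Open Scope ring_scope.
Local Open Scope sesquilinear_scope.

(* The exponent c of CS has third difference 2 Tr(xyz) modulo 4.  Summed over
   the columns of G, the third difference of the exponent of D_G is therefore
   2 Tr of the trilinear form with tensor sum_i g_ai g_bi g_ci, which the cubic
   condition makes equal to x_1 y_1 z_1: this is also the third difference of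
   the exponent of CS on the first qudit.  So the exponent q of D_G (CS (x) I)^-1 has vanishing third
   difference, and E(u, s) = q(u+s) - q(u) - q(s) is biadditive on a group of
   exponent 2; conjugation by i^q then multiplies an X string by a character
   with values +1 and -1, that is, by a Pauli Z string.

   Distance 3: the columns of the stabilizer rows are pairwise independent over
   F_4, so no nonzero vector of weight at most 2 is orthogonal to these rows. *)

(** * Arithmetic of F_4 on pairs of bits *)

Section FourElements.
Variables (F : finFieldType) (hF : #|F| = 4%N) (w : F) (hw : w ^+ 2 = w + 1).
Local Notation qudit := (qudit_of_bits w).

Definition bits_add (b c : bool * bool) := (b.1 (+) c.1, b.2 (+) c.2).

(* w * w^2 = w + w^2 and w^2 * w^2 = w. *)
Definition bits_mul (b c : bool * bool) :=
  let cross := (b.1 && c.2) (+) (b.2 && c.1) in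
  (cross (+) (b.2 && c.2), cross (+) (b.1 && c.1)).

Lemma bitsK : cancel (bits w) qudit.
Proof. by move=> g; apply/esym/eqP; rewrite -bitsP. Qed.

Lemma quditK : cancel qudit (bits w).
Proof. by move=> b; apply/eqP; rewrite bitsP. Qed.

Lemma quditD b c : qudit b + qudit c = qudit (bits_add b c).
Proof.
rewrite /qudit_of_bits /= addrACA; move: b c => [b1 b2] [c1 c2] /=.
have D (x : F) (b c : bool) : x *+ b + x *+ c = x *+ (b (+) c).
  by case: b c => [] [] /=; rewrite ?F4_addrr ?addr0 ?add0r ?mulr0n.
by rewrite !D.
Qed.

Lemma w_sum : w + w ^+ 2 = 1.
Proof. by rewrite hw addrA F4_addrr // add0r. Qed.

Lemma w_cube : w ^+ 3 = 1.
Proof. by rewrite exprS hw mulrDr mulr1 -expr2 addrC w_sum. Qed.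

Lemma quditM b c : qudit b * qudit c = qudit (bits_mul b c).
Proof.
have q0 (x : F) : x *+ false = 0 by [].
have q1 (x : F) : x *+ true = x by [].
have w4 : w * w ^+ 3 = w by rewrite w_cube mulr1.
case: b c => [] [] [] [[] []]; rewrite /qudit_of_bits /bits_mul /= ?(q0, q1);
  rewrite ?(addr0, add0r, mulr0, mul0r, w_sum, mulr1, mul1r) //.
- by rewrite -exprS w_cube.
- by rewrite -exprSr w_cube.
- by rewrite -exprD exprS w4.
Qed.

Lemma bitsD x y : bits w (x + y) = bits_add (bits w x) (bits w y).
Proof. by rewrite -{1}[x]bitsK -{1}[y]bitsK quditD quditK. Qed.

Lemma bitsM x y : bits w (x * y) = bits_mul (bits w x) (bits w y).
Proof. by rewrite -{1}[x]bitsK -{1}[y]bitsK quditM quditK. Qed.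

Lemma bits0 : bits w 0 = (false, false).
Proof. by rewrite -[0](_ : qudit (false, false) = 0) ?quditK // /qudit_of_bits addr0. Qed.

(** Bridge to the tables: with [h] defined on naturals, a sum in the abstract field becomes a closed
    fold of bit pairs, which [vm_compute] can evaluate. *)
Lemma qudit_sum n (h : nat -> bool * bool) :
  \sum_(i < n) qudit (h i) =
  qudit (foldr bits_add (false, false) [seq h i | i <- iota 0 n]).
Proof.
rewrite -(big_mkord xpredT (fun i => qudit (h i))) /index_iota subn0.
elim: (iota 0 n) => [|i s IH]; first by rewrite big_nil /qudit_of_bits addr0.
by rewrite big_cons IH quditD.
Qed.

End FourElements.

(** * Powers of i and the trace character *)

Section Phases.
Variables (C : numClosedFieldType) (F : finFieldType) (hF : #|F| = 4%N).
Variables (w : F) (hw : w ^+ 2 = w + 1).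
Local Notation cs g := ('i ^+ cphase w g : C).

(* The nontrivial additive character (-1) ^ Tr g: the trace of w and of w^2
   is 1. *)
Definition trace_sign (g : F) : C := (-1) ^+ ((bits w g).1 (+) (bits w g).2).

Lemma trace_signD : {morph trace_sign : x y / x + y >-> x * y}.
Proof.
move=> x y; rewrite /trace_sign bitsD //= -signr_addb.
by congr (_ ^+ _); case: (bits w x) (bits w y) => [[] []] [[] []].
Qed.

Lemma trace_sign0 : trace_sign 0 = 1.
Proof. by rewrite /trace_sign bits0. Qed.

Lemma expi4 : 'i ^+ 4 = 1 :> C.
Proof. by rewrite (exprM _ 2 2) sqrCi expr2 mulrNN mulr1. Qed.

Lemma expi_neq0 n : 'i ^+ n != 0 :> C.
Proof. by rewrite expf_neq0 // neq0Ci. Qed.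

Lemma conj_expi n : ('i ^+ n)^* = ('i ^+ n)^-1 :> C.
Proof. by rewrite rmorphXn /= conjCi -exprVn invCi. Qed.

(* The third difference of [cphase] is [2 * Tr (x * y * z)] modulo [4]. *)
Lemma cs_cubic x y z :
  cs (x + y + z) * (cs x * cs y * cs z) =
  trace_sign (x * y * z) * (cs (x + y) * cs (x + z) * cs (y + z)).
Proof.
rewrite /trace_sign /cphase !bitsM ?bitsD //.
have i0 : 'i ^+ false = 1 :> C by [].
have i1 : 'i ^+ true = 'i :> C by [].
case: (bits w x) (bits w y) (bits w z) => [[] []] [[] []] [[] []] /=;
  rewrite ?(i0, i1, expr0, expr1, mulr1, mul1r) -?expr2 ?sqrCi //;
  rewrite ?mulN1r ?opprK -?expr2 ?sqrCi ?mulrN1 ?opprK ?mulN1r ?mulrN ?mulNr;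
  by rewrite -?expr2 ?sqrCi ?opprK.
Qed.

End Phases.

(** * Matrices of diagonal operators *)

Section Operators.
Variables (C : numClosedFieldType) (T : finType).

Lemma opmx_diag (f : T -> C) :
  opmx (diagop f) = diag_mx (\row_p f (enum_val p)).
Proof. by apply/matrixP=> p r; rewrite !mxE /diagop (inj_eq enum_val_inj). Qed.

Lemma opmx_conj_diag (f : T -> C) (A : T -> T -> C) :
  opmx (diagop f) *m opmx A *m (opmx (diagop f)) ^t* =
  opmx (fun u v => f u * A u v * (f v)^*).
Proof.
rewrite !opmx_diag tr_diag_mx map_diag_mx mul_diag_mx mul_mx_diag.
by apply/matrixP=> p r; rewrite !mxE.
Qed.

Lemma opmx_diagM (f g : T -> C) :
  opmx (diagop f) *m opmx (diagop g) = opmx (diagop (fun u => f u * g u)).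
Proof.
rewrite !opmx_diag mul_diag_mx; apply/matrixP=> p r.
by rewrite !mxE mulrnAr.
Qed.

Lemma opmx_diag_unitary (f : T -> C) :
  (forall u, f u * (f u)^* = 1) -> opmx (diagop f) \is unitarymx.
Proof.
move=> f1; apply/unitarymxP.
rewrite opmx_diag tr_diag_mx map_diag_mx mul_diag_mx.
by apply/matrixP=> p r; rewrite !mxE mulrnAr f1.
Qed.

Lemma tensop_diag (I : finType) (f : I -> T -> C) (u v : {ffun I -> T}) :
  tensop (fun i => diagop (f i)) u v =
  diagop (fun u : {ffun I -> T} => \prod_i f i (u i)) u v.
Proof.
rewrite /tensop /diagop; case: eqP => [<-|/eqP nuv].
  by rewrite mulr1n; apply: eq_bigr => i _; rewrite eqxx mulr1n.
have /existsP[i ni] : [exists i, u i != v i].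
  apply: contraR nuv => /existsPn uv.
  by apply/eqP/ffunP=> i; apply/eqP/negPn/uv.
by rewrite mulr0n (bigD1 i) //= (negPf ni) mulr0n mul0r.
Qed.

End Operators.

(** * Diagonal Clifford operators from phases with vanishing third difference *)

Section DiagonalClifford.
Variables (C : numClosedFieldType) (F : finFieldType) (hF : #|F| = 4%N).
Variables (w : F) (hw : w ^+ 2 = w + 1) (m : nat).
Local Notation state := {ffun 'I_m -> F}.

Lemma qubitsD (u v : state) p :
  qubits w (u + v) p = qubits w u p (+) qubits w v p.
Proof. by rewrite !ffunE !bitsD //; case: (p.2). Qed.

Lemma qubits_inj : injective (@qubits F w m).
Proof.
move=> u v uv; apply/ffunP=> a; rewrite -[u a](bitsK hF hw) -[v a](bitsK hF hw).
have /ffunP bitsE := uv; have := bitsE (a, false); have := bitsE (a, true); rewrite !ffunE /=.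
by case: (bits w (u a)) (bits w (v a)) => [b1 b2] [c1 c2] /= -> ->.
Qed.

Lemma qubits_surj (b : {ffun 'I_m * bool -> bool}) : exists u, qubits w u = b.
Proof.
exists [ffun a => qudit_of_bits w (b (a, false), b (a, true))].
by apply/ffunP=> [[a []]]; rewrite !ffunE /= quditK.
Qed.

(** The state in which only the qubit [p] is set; these states form an F_2-basis. *)
Definition basis_state (p : 'I_m * bool) : state :=
  [ffun a => (if p.2 then w ^+ 2 else w) *+ (a == p.1)].

Lemma state_sum (u : state) : u = \sum_p basis_state p *+ qubits w u p.
Proof.
apply/ffunP=> a; rewrite sum_ffunE.
transitivity (\sum_i \sum_j (basis_state (i, j) *+ qubits w u (i, j)) a);
  last by rewrite pair_bigA; apply: eq_bigr => -[].
rewrite (bigD1 a) //= [X in _ + X]big1 ?addr0 => [|i /negPf ia].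
  rewrite big_bool /= !ffunMnE /basis_state !ffunE /= eqxx addrC.
  by rewrite -[LHS](bitsK hF hw).
by rewrite big_bool /= !ffunMnE !ffunE /= eq_sym ia !mul0rn addr0.
Qed.

Lemma state_addrr (u : state) : u + u = 0.
Proof. by apply/ffunP=> a; rewrite !ffunE F4_addrr. Qed.

(** Since u + u = 0, the values of [chi] are 1 and -1, so its signs on the F_2-basis determine it.
    Such a character is the diagonal of a Pauli Z string. *)
Lemma state_character (chi : state -> C) :
  chi 0 = 1 -> {morph chi : u v / u + v >-> u * v} ->
  exists beta : 'I_m * bool -> bool,
    forall u, chi u = \prod_p (-1) ^+ (beta p && qubits w u p).
Proof.
move=> chi0 chiD; exists (fun p => chi (basis_state p) != 1) => u.
rewrite [in LHS](state_sum u) (big_morph chi chiD chi0).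
apply: eq_bigr => p _; case: (qubits w u p); rewrite ?andbF //= andbT mulr1n.
have : chi (basis_state p) ^+ 2 == 1 by rewrite expr2 -chiD state_addrr chi0.
by rewrite sqrf_eq1; case: eqP => [->|_ /= /eqP].
Qed.

(** The X part of the label in the symplectic description of Pauli operators. *)
Definition pauli_flips (P : pauli_label) :=
  match P with PauliI | PauliZ => false | _ => true end.

Lemma pauli1_support P x y :
  pauli1 C P x y != 0 -> y = x (+) pauli_flips P.
Proof. by case: P x y => [] [] [] //=; rewrite ?mulr0n ?eqxx. Qed.

(** The sign is a left factor Z, and ZI = Z, ZX = iY, ZY = -iX, ZZ = I. *)
Lemma pauli1_signl (b : bool) P : exists k P', forall x y,
  (-1) ^+ (b && x) * pauli1 C P x y = 'i ^+ k * pauli1 C P' x y.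
Proof.
case: b; last by exists 0%N, P => x y.
have i3 : 'i ^+ 3 = - 'i :> C by rewrite exprS sqrCi mulrN1.
case: P.
- by exists 0%N, PauliZ => [] [] [] /=; rewrite ?mulr0 ?mul1r ?mulr1.
- exists 1%N, PauliY => [] [] [] /=; rewrite ?mulr0 ?mulr1 //.
    by rewrite -expr2 sqrCi.
  by rewrite expr1 mulrN -expr2 sqrCi opprK.
- exists 3%N, PauliX => [] [] [] /=; rewrite i3 ?mulr0 ?mulr1 //.
    by rewrite mulN1r.
  by rewrite mul1r.
- exists 0%N, PauliI => [] [] [] /=; rewrite ?mulr0n ?mulr0 ?mulr1 //.
  by rewrite mulrNN mulr1.
Qed.

Lemma diag_clifford (q : state -> nat) :
  (forall x y z, 'i ^+ (q (x + y + z) + (q x + q y + q z)) =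
                 'i ^+ (q (x + y) + q (x + z) + q (y + z)) :> C) ->
  is_clifford w (opmx (diagop (fun u => 'i ^+ q u : C))).
Proof.
move=> q3; set f := fun u => 'i ^+ q u : C.
have f_neq0 u : f u != 0 by apply: expi_neq0.
have f_conj u : (f u)^* = (f u)^-1 by apply: conj_expi.
have f3 x y z : f (x + y + z) * (f x * f y * f z) =
                f (x + y) * f (x + z) * f (y + z).
  by rewrite /f -!exprD q3.
(* At x = y = z = 0 the identity reads f(0)^4 = f(0)^3. *)
have f0 : f 0 = 1.
  have f000 : f 0 * f 0 * f 0 != 0 by rewrite !mulf_neq0.
  by apply: (mulIf f000); have := f3 0 0 0; rewrite !addr0 mul1r.
split; first by apply: opmx_diag_unitary => u; rewrite f_conj mulfV.
move=> A [k [P ->]].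
(* The Pauli string has nonzero entries only where v = u + s. *)
have [s sP] := qubits_surj [ffun p => pauli_flips (P p)].
have sE p : qubits w s p = pauli_flips (P p) by rewrite sP ffunE.
(* This is i^E(u, s); [f3] makes it multiplicative in u. *)
pose chi u := f (u + s) / (f u * f s).
have chi0 : chi 0 = 1 by rewrite /chi add0r f0 mul1r mulfV.
have chiD : {morph chi : u v / u + v >-> u * v}.
  move=> u v; rewrite /chi mulf_div; apply/eqP.
  rewrite eqr_div ?mulf_neq0 //; apply/eqP.
  transitivity (f (u + v + s) * (f u * f v * f s) * f s); first by ring.
  by rewrite f3; ring.
have chi_neq0 u : chi u != 0 by rewrite mulf_neq0 ?invr_neq0 ?mulf_neq0.
have chi2 u : chi u * chi u = 1 by rewrite -chiD state_addrr.
have [beta betaE] := state_character chi0 chiD.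
have /fin_all_exists[k' /fin_all_exists[P' kP]] p := pauli1_signl (beta p) (P p).
(* The term [3 * q s] yields 1 / f(s), because i^4 = 1; [k'] collects the phases of the products
   with Z on each qubit. *)
exists (k + (3 * q s + \sum_p k' p))%N, P'.
rewrite -scalemxAr -scalemxAl opmx_conj_diag exprD -scalerA; congr (_ *: _).
apply/matrixP=> a b; rewrite !mxE; move: (enum_val a) (enum_val b) => u v.
set T := tensop _ _ _.
(* Unless [T] vanishes, v = u + s and f(u) / f(u + s) = 1 / (f(s) chi(u)), where chi(u) is its own
   inverse. *)
have -> : f u * T * (f v)^* = (f s)^-1 * (chi u * T).
  have [->|T_neq0] := eqVneq T 0; first by rewrite !mulr0 mul0r.
  have -> : v = u + s.
    apply: qubits_inj; apply/ffunP=> p; rewrite qubitsD sE.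
    apply: pauli1_support; have := T_neq0; rewrite /T /tensop.
    by move/prodf_neq0; apply.
  have <- : (chi u)^-1 = chi u by rewrite -[LHS]mulr1 -(chi2 u) mulKf.
  rewrite /chi invf_div f_conj; field.
  by rewrite !f_neq0.
rewrite exprD; have -> : 'i ^+ (3 * q s) = (f s)^-1 :> C.
  by apply: (mulIf (f_neq0 s)); rewrite mulVf // /f -exprD -mulSnr exprM expi4 expr1n.
rewrite -mulrA betaE /T /tensop -!big_split /= -prodrXr -big_split /=.
by congr (_ * _); apply: eq_bigr => p _; apply: kP.
Qed.

End DiagonalClifford.

(** * From the cubic condition to the factorization of D_G *)

Section CubicCondition.
Variables (C : numClosedFieldType) (F : finFieldType) (hF : #|F| = 4%N).
Variables (w : F) (hw : w ^+ 2 = w + 1) (m n : nat) (G : 'M[F]_(m.+1, n)).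
Local Notation state := {ffun 'I_m.+1 -> F}.
Local Notation cs g := ('i ^+ cphase w g : C).
Local Notation out u i := (\sum_a u a * G a i).

Hypothesis G_cubic : forall a b c, \sum_i G a i * G b i * G c i =
  if [&& a == ord0, b == ord0 & c == ord0] then 1 else 0.

Lemma cubic_form (x y z : state) :
  \sum_i out x i * out y i * out z i = x ord0 * y ord0 * z ord0.
Proof.
transitivity (\sum_a \sum_b \sum_c
    x a * y b * z c * \sum_i G a i * G b i * G c i).
  transitivity (\sum_i \sum_a \sum_b \sum_c
      x a * y b * z c * (G a i * G b i * G c i)).
    apply: eq_bigr => i _; rewrite big_distrlr mulr_suml; apply: eq_bigr => a _.
    rewrite mulr_suml; apply: eq_bigr => b _.
    by rewrite mulr_sumr; apply: eq_bigr => c _ /=; ring.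
  rewrite exchange_big; apply: eq_bigr => a _.
  rewrite exchange_big; apply: eq_bigr => b _.
  rewrite exchange_big; apply: eq_bigr => c _.
  by rewrite mulr_sumr.
under eq_bigr do under eq_bigr do under eq_bigr do rewrite G_cubic.
rewrite (bigD1 ord0) //= [X in _ + X]big1 => [|a /negPf na]; last first.
  by rewrite big1 // => b _; rewrite big1 // => c _; rewrite na mulr0.
rewrite (bigD1 ord0) //= [X in _ + X + _]big1 => [|b /negPf nb]; last first.
  by rewrite big1 // => c _; rewrite nb mulr0.
rewrite (bigD1 ord0) //= [X in _ + X + _ + _]big1 => [|c /negPf nc]; last first.
  by rewrite nc mulr0.
by rewrite mulr1 !addr0.
Qed.

Lemma out_add (x y : state) i : out (x + y) i = out x i + out y i.
Proof. by rewrite -big_split; apply: eq_bigr => a _; rewrite ffunE mulrDl. Qed.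

(** The product of [cs_cubic] over the columns: the signs multiply to the sign of a sum, which
    [cubic_form] evaluates. *)
Lemma cs_prod_cubic (x y z : state) (h := fun u : state => \prod_i cs (out u i)) :
  h (x + y + z) * (h x * h y * h z) =
  trace_sign C w (x ord0 * y ord0 * z ord0) * (h (x + y) * h (x + z) * h (y + z)).
Proof.
rewrite -cubic_form.
rewrite (big_morph _ (trace_signD C hF hw) (trace_sign0 C hF hw)).
rewrite /h -!big_split; apply: eq_bigr => i _ /=.
by rewrite !out_add cs_cubic.
Qed.

(* Dividing by [cs (u ord0)] cancels
   the signs [trace_sign (x ord0 * y ord0 * z ord0)]. *)
Lemma cubic_condition_clifford : exists U : 'M[C]_#|{ffun 'I_m.+1 -> F}|,
  [/\ is_diag_mx U, is_clifford w U & D_ C w G = U *m CS_first C w m].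
Proof.
have [q qE] : exists q : state -> nat, forall u,
    'i ^+ q u = (\prod_i cs (out u i)) / cs (u ord0) :> C.
  (* Modulo 4 the factor 3 is -1, so the quotient keeps a natural exponent. *)
  exists (fun u => \sum_i cphase w (out u i) + 3 * cphase w (u ord0))%N => u.
  rewrite exprD prodrXr; congr (_ * _).
  apply: (mulIf (expi_neq0 C (cphase w (u ord0)))).
  by rewrite mulVf ?expi_neq0 // -exprD -mulSnr exprM expi4 expr1n.
exists (opmx (diagop (fun u => 'i ^+ q u))); split.
- by rewrite opmx_diag diag_mx_is_diag.
- apply: diag_clifford => // x y z; rewrite !exprD !qE.
  have := cs_prod_cubic x y z; have := cs_cubic C hF hw (x ord0) (y ord0) (z ord0).
  rewrite !ffunE.
  set t := trace_sign _ _ _; have t0 : t != 0 by rewrite signr_eq0.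
  move=> E1 E2.
  rewrite !mulf_div E2 E1 invfM.
  field.
  by rewrite t0 !expi_neq0.
- have -> : CS_first C w m = opmx (diagop (fun u : state => cs (u ord0))).
    apply/matrixP=> a b; rewrite !mxE.
    (* The case distinction moves inside [diagop], the form required by [tensop_diag]. *)
    transitivity (tensop (fun i => diagop (fun g => if i == ord0 then cs g else 1))
                    (enum_val a) (enum_val b)).
      by apply: eq_bigr => i _; case: eqP.
    rewrite tensop_diag /diagop (bigD1 ord0) //= big1 ?mulr1 // => i /negPf -> //.
  rewrite opmx_diagM; apply/matrixP=> a b; rewrite !mxE /diagop qE.
  by rewrite divfK ?expi_neq0 // prodrXr.
Qed.

End CubicCondition.

(** * A lower bound on the Z-distance from 2 by 2 minors *)

Section Distance.
Variables (F : finFieldType) (k r n : nat) (G : 'M[F]_(k + r, n.+2)).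

Lemma Z_weight_ge3 (x : 'rV[F]_n.+2) :
  (forall i j, i != j -> exists a b : 'I_r,
     G (rshift k a) i * G (rshift k b) j != G (rshift k a) j * G (rshift k b) i) ->
  nontrivial_Z G x -> (3 <= hweight x)%N.
Proof.
move=> minorG [xS [l xl]]; rewrite ltnNge; apply/negP=> x2.
(* With [n.+2] columns, two distinct positions covering the support exist even when [x] has fewer
   than two nonzero entries. *)
have [i [j [ij xij]]] : exists i j, i != j /\ forall l, l != i -> l != j -> x 0 l = 0.
  have [i xi|x0] := pickP (fun i => x 0 i != 0); last first.
    by exists ord0, ord_max; split=> // p _ _; apply/eqP/negbFE/x0.
  have [j /andP[ji xj]|x0] := pickP (fun j => (j != i) && (x 0 j != 0)); last first.
    exists i, (lift i ord0); rewrite neq_lift; split=> // p pi _.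
    by apply/eqP/negbFE; have := x0 p; rewrite pi.
  exists i, j; rewrite eq_sym ji; split=> // p pi pj; apply/eqP/negPn/negP=> xp.
  move: x2; rewrite leqNgt => /negP; apply; apply/card_gt2P; exists i, j, p.
  by rewrite !inE eq_sym; split; split=> //; rewrite eq_sym.
have dotE y : dotv x y = x 0 i * y 0 i + x 0 j * y 0 j.
  rewrite /dotv (bigD1 i) // (bigD1 j) 1?eq_sym //= big1 ?addr0 // => l' /andP[l'i l'j].
  by rewrite xij // mul0r.
have [a [b ab]] := minorG i j ij.
have := xS a; have := xS b; rewrite !dotE !mxE => Eb Ea.
have d0 := ab; rewrite -subr_eq0 in d0.
apply: xl; rewrite dotE.
suff [-> ->] : x 0 i = 0 /\ x 0 j = 0 by rewrite !mul0r addr0.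
set p := G (rshift k a) i in Ea ab d0 *; set s := G (rshift k b) j in Eb ab d0 *.
set t := G (rshift k a) j in Ea ab d0 *; set v := G (rshift k b) i in Eb ab d0 *.
(* Cramer's rule: each coordinate times the minor is a combination of the two stabilizer
   equations. *)
split; apply: (mulIf d0); rewrite mul0r.
- transitivity ((x 0 i * p + x 0 j * t) * s - (x 0 i * v + x 0 j * s) * t); first by ring.
  by rewrite Ea Eb !mul0r subr0.
- transitivity ((x 0 i * v + x 0 j * s) * p - (x 0 i * p + x 0 j * t) * v); first by ring.
  by rewrite Ea Eb !mul0r subr0.
Qed.

End Distance.

(** * Finite checks on the matrix in bit coordinates *)

Section Tables.
Local Notation o := (false, false).
Local Notation l := (true, true).
Local Notation w := (true, false).
Local Notation v := (false, true).
Local Notation sum_bits h n := (foldr bits_add o [seq h i | i <- iota 0 n]).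

(** The default is zero, so tables may omit trailing zeros and empty rows. *)
Definition entry (s : seq (seq (bool * bool))) i j := nth o (nth [::] s i) j.

(** The letters [o], [l], [w], [v] are the bits of 0, 1, w, w^2; 1 has both bits set since w + w^2 =
    1. *)
Definition G12_bits :=
  [:: [:: o; o; l; o; o; l; o; v; l; w; v; w];
      [:: o; o; o; o; l; l; l; l; l; l; l; l];
      [:: o; l; l; l; w; v; o; o; o; l; l; l];
      [:: l; l; w; v; o; o; l; w; v; l; w; v]].

(* The unit vectors as combinations of columns 0, 1, 2 and 4 of [G12]. *)
Definition G12_rinv_bits :=
  [:: [:: v; w; l; l]; [:: l; w; l; o]; [:: l]; [::]; [:: o; l]].

(* Column 1 plus column 2 is w^2 times column 0 on the stabilizer rows. *)
Definition G12_light_bits := [:: v; l; l].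

Local Notation g := (entry G12_bits).

Lemma G12_cubic_table : all (fun a => all (fun b => all (fun c =>
    sum_bits (fun i => bits_mul (bits_mul (g a i) (g b i)) (g c i)) 12 ==
    if [&& a == 0, b == 0 & c == 0]%N then l else o)
  (iota 0 4)) (iota 0 4)) (iota 0 4).
Proof. by vm_compute. Qed.

Lemma G12_rinv_table : all (fun a => all (fun b =>
    sum_bits (fun i => bits_mul (g a i) (entry G12_rinv_bits i b)) 12 ==
    if a == b then l else o)
  (iota 0 4)) (iota 0 4).
Proof. by vm_compute. Qed.

Lemma G12_light_table : all (fun a =>
    sum_bits (fun i => bits_mul (nth o G12_light_bits i) (g a i)) 12 ==
    if a == 0%N then l else o)
  (iota 0 4).
Proof. by vm_compute. Qed.

(** The shift [.+1] skips the logical row, so these are minors of the stabilizer rows. *)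
Lemma G12_minor_table : all (fun i => all (fun j => (i == j) ||
    has (fun a => has (fun b =>
      bits_mul (g a.+1 i) (g b.+1 j) != bits_mul (g a.+1 j) (g b.+1 i))
    (iota 0 3)) (iota 0 3))
  (iota 0 12)) (iota 0 12).
Proof. by vm_compute. Qed.

End Tables.

(** * Transfer of the tables to the field *)

Section Matrix12.
Variables (F : finFieldType) (hF : #|F| = 4%N) (w : F) (hw : w ^+ 2 = w + 1).
Local Notation qudit := (qudit_of_bits w).

Lemma qudit0 : qudit (false, false) = 0.
Proof. exact: addr0. Qed.

Lemma qudit1 : qudit (true, true) = 1.
Proof. exact: w_sum. Qed.

Lemma mem_iota_ord n (i : 'I_n) : val i \in iota 0 n.
Proof. by rewrite mem_iota ltn_ord. Qed.

Lemma G12E a i : G12 w a i = qudit (entry G12_bits a i).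
Proof.
have rowsE : G12_rows w = [seq [seq qudit b | b <- s] | s <- G12_bits].
  by rewrite /= qudit0 qudit1 /qudit_of_bits /= mulr0n mulr1n addr0 add0r.
rewrite mxE rowsE (nth_map [::]) ?(nth_map (false, false)) //.
by case: a => [[|[|[|[|]]]]].
Qed.

Lemma G12_cubic a b c : \sum_(i < 12) G12 w a i * G12 w b i * G12 w c i =
  if [&& a == ord0, b == ord0 & c == ord0] then 1 else 0.
Proof.
under eq_bigr do rewrite !G12E !quditM //.
rewrite (qudit_sum hF w _ (fun i => bits_mul (bits_mul (entry G12_bits a i)
  (entry G12_bits b i)) (entry G12_bits c i))).
have /allP/(_ _ (mem_iota_ord a))/allP/(_ _ (mem_iota_ord b)) := G12_cubic_table.
move=> /allP/(_ _ (mem_iota_ord c))/eqP ->.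
by rewrite (fun_if qudit) qudit0 qudit1.
Qed.

Lemma G12_rank : \rank (G12 w) = 4%N.
Proof.
apply/eqP; change (row_free (G12 w)); apply/row_freeP.
exists (\matrix_(i, b) qudit (entry G12_rinv_bits i b)).
apply/matrixP=> a b; rewrite !mxE.
under eq_bigr do rewrite G12E mxE quditM //.
rewrite (qudit_sum hF w _ (fun i => bits_mul (entry G12_bits a i)
  (entry G12_rinv_bits i b))).
have /allP/(_ _ (mem_iota_ord a))/allP/(_ _ (mem_iota_ord b))/eqP -> := G12_rinv_table.
by rewrite (fun_if qudit) qudit0 qudit1 -val_eqE; case: eqP.
Qed.

Lemma qudit_inj : injective qudit.
Proof. exact: can_inj (quditK hF hw). Qed.

Lemma G12_Zdistance : @is_Zdistance F 1 3 12 (G12 w) 3.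
Proof.
split=> [|x]; last first.
  apply: Z_weight_ge3 => i j ij.
  have /allP/(_ _ (mem_iota_ord i))/allP/(_ _ (mem_iota_ord j)) := G12_minor_table.
  rewrite val_eqE (negPf ij) => /hasP[a a3 /hasP[b b3 ab]].
  rewrite mem_iota in a3; rewrite mem_iota in b3.
  exists (Ordinal a3), (Ordinal b3); rewrite !G12E !quditM //.
  by rewrite (inj_eq qudit_inj).
(* From index 3 on, the default of [nth] gives zero entries, so the weight is 3. *)
pose x : 'rV[F]_12 :=
  \row_(i < 12) qudit (nth (false, false) G12_light_bits (i : 'I_12)).
have xG a : dotv x (row a (G12 w)) = if a == ord0 then 1 else 0.
  rewrite /dotv; under eq_bigr do rewrite [row _ _ _ _]mxE G12E mxE quditM //.
  rewrite (qudit_sum hF w _ (fun i => bits_mul (nth (false, false) G12_light_bits i)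
    (entry G12_bits a i))).
  have /allP/(_ _ (mem_iota_ord a))/eqP -> := G12_light_table.
  by rewrite (fun_if qudit) qudit0 qudit1.
exists x.
  split=> [j|]; first by rewrite xG.
  by exists ord0; rewrite xG /=; apply/eqP; rewrite oner_eq0.
rewrite /hweight -sum1_card (eq_bigl (fun i : 'I_12 => (i < 3)%N)).
  by rewrite big_mkcond /= !big_ord_recl big_ord0.
move=> i; rewrite inE mxE -qudit0 (inj_eq qudit_inj).
by case: i => [[|[|[|[|[|[|[|[|[|[|[|[|]]]]]]]]]]]]].
Qed.

End Matrix12.

Theorem mainTheorem12 (C : numClosedFieldType) (F : finFieldType)
    (hF : #|F| = 4%N) (w : F) (hw : w ^+ 2 = w + 1) :
  [/\ \rank (G12 w) = 4%N,
      forall a b c : 'I_(1 + 3),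
        \sum_(i < 12) G12 w a i * G12 w b i * G12 w c i =
          (if [&& a == ord0, b == ord0 & c == ord0] then 1 else 0),
      exists U : 'M[C]_#|{ffun 'I_(1 + 3) -> F}|,
        [/\ is_diag_mx U, is_clifford w U &
            D_ C w (G12 w) = U *m CS_first C w 3]
    & is_Zdistance (G12 w) 3].
Proof.
split; [exact: G12_rank | exact: G12_cubic | | exact: G12_Zdistance].
exact: cubic_condition_clifford (G12_cubic hF hw).
Qed.
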